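(* Let $n \ge 2$, $\phi = \frac{1+\sqrt5}{2}$, $a(k) = \lfloor k\phi \rfloor$, and $D_1 = \{(2^{n-1}-1)a(k)+k : k \ge 1\}$, $D_2 = D_1 \pm 2^{n-2} = \{x - 2^{n-2} : x \in D_1\}\cup\{x+2^{n-2}: x \in D_1\}$. Writing the elements of $D_2$ in increasing order $d_{2,1} < d_{2,2} < \cdots$ and setting $D_2(k) = d_{2,k}$, we have \[ D_2(k) = a(k) + (2^{n-1}-2)k - (2^{n-2}-1) \quad \text{for all } k \ge 1. \] *)

(* Defs.v *)
From mathcomp Require Import all_boot all_order all_algebra.
From mathcomp Require Import classical_sets reals.

Set Implicit Arguments.
Unset Strict Implicit.
Unset Printing Implicit Defensive.

Import Order.TTheory GRing.Theory Num.Theory.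

Local Open Scope classical_set_scope.
Local Open Scope ring_scope.

Definition phi (R : realType) : R := (1 + Num.sqrt 5) / 2.

Definition a (R : realType) (k : nat) : int := Num.floor (k%:R * phi R).

Definition D1 (R : realType) (n : nat) : set int :=
  [set (2 ^+ (n - 1) - 1) * a R k + k%:Z | k in [set k : nat | (1 <= k)%N]].

Definition set_pm (D : set int) (c : int) : set int :=
  [set x - c | x in D] `|` [set x + c | x in D].

Definition D2 (R : realType) (n : nat) : set int :=
  set_pm (D1 R n) (2 ^+ (n - 2)).

(* d 1 < d 2 < ... lists exactly the elements of D; the value d 0 is
   irrelevant, since indices start at 1. *)
Definition increasing_enum (D : set int) (d : nat -> int) : Prop :=
  (forall i j : nat, (1 <= i < j)%N -> d i < d j) /\
  [set d k | k in [set k : nat | (1 <= k)%N]] = D.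

(* Main.v *)
(* Put m = 2 ^ (n - 2) and E k = a k + (2 m - 2) k - (m - 1).  If j phi = a j + f,
   then phi ^ 2 = phi + 1 gives phi (a j) = a j + j - f (phi - 1), where 0 < f < 1
   because phi is irrational; hence a (a j) = a j + j - 1 and
   a (a j + 1) = a j + j + 1.  These say that E (a j) and E (a j + 1) are the two
   points x - m and x + m of D2 attached to the j-th element x of D1.  Since
   a 1 = 1 and a increases by 1 or 2 at each step, every index is of the form
   a j or a j + 1, so the strictly increasing sequence E enumerates D2. *)
Require Import Defs.
From mathcomp Require Import all_boot all_order all_algebra.
From mathcomp Require Import classical_sets reals.
From mathcomp Require Import zify ring lra.

Import Order.TTheory GRing.Theory Num.Theory.
Local Open Scope ring_scope.

(** Carries the explicit formula over to an arbitrary enumeration, by strong induction on the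
    index. *)
Lemma increasing_enum_uniq {D : set int} {d e : nat -> int} :
  increasing_enum D d -> increasing_enum D e ->
  forall k : nat, (1 <= k)%N -> d k = e k.
Proof.
have half (d1 d2 : nat -> int) (k : nat) :
    increasing_enum D d1 -> increasing_enum D d2 -> (1 <= k)%N ->
    (forall i, (1 <= i < k)%N -> d1 i = d2 i) -> d2 k <= d1 k.
  move=> [inc1 im1] [inc2 im2] k1 eq12.
  have : D (d1 k) by rewrite -im1; exists k.
  (* The value [d1 k] is some [d2 j]; if [j < k], agreement below [k] would make [d1] take it
     twice. *)
  rewrite -im2 => -[j /= j1 dj]; rewrite -dj.
  have [jk|kj|->//] := ltngtP j k.
    have jb : (1 <= j < k)%N by rewrite j1.
    by have := inc1 _ _ jb; rewrite eq12 // dj ltxx.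
  by apply/ltW/inc2; rewrite k1.
move=> Hd He; elim/ltn_ind => k IH k1.
apply/le_anti/andP; split; apply: half => // i /andP[i1 ik].
  by rewrite IH.
by rewrite -IH.
Qed.

(** Irrationality of [phi] by infinite descent: if [j > 0] then [j < x < 2 j], and [(j, x - j)]
    solves the same equation with a smaller second entry. *)
Lemma golden_int_eq (j x : nat) : (x * x = x * j + j * j)%N -> j = 0%N.
Proof.
elim/ltn_ind: j x => j IH x Hx.
have [//|j0] := posnP j.
have jx : (j < x)%N by nia.
have xj : (x - j < j)%N by nia.
have := IH _ xj j; nia.
Qed.

Section GoldenBeatty.
Variable R : realType.
Local Notation phi := (phi R).
Local Notation a := (a R).

Lemma phi_sqr : phi * phi = phi + 1.
Proof.
have s5 : Num.sqrt (5 : R) ^+ 2 = 5 by rewrite sqr_sqrtr.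
rewrite /Defs.phi; lra.
Qed.

Lemma phi_bounds : 1 < phi < 2.
Proof.
have p0 : 0 < phi by rewrite divr_gt0 // ltr_pwDl // sqrtr_ge0.
have := phi_sqr; nra.
Qed.

Lemma a_bounds (k : nat) : (a k)%:~R <= k%:R * phi < (a k)%:~R + 1.
Proof. by have := floor_itv (k%:R * phi); rewrite intrD. Qed.

Lemma a_eq (k : nat) (z : int) :
  z%:~R <= k%:R * phi < z%:~R + 1 -> a k = z.
Proof. by move=> H; apply: floor_def; rewrite intrD. Qed.

Lemma a1 : a 1 = 1.
Proof. by apply: a_eq; have := phi_bounds; lra. Qed.

Lemma a_step (k : nat) : a k + 1 <= a k.+1 <= a k + 2.
Proof.
have := a_bounds k; have := a_bounds k.+1; have := phi_bounds.
rewrite -natr1 => p H1 H0; apply/andP; split; rewrite -ltzD1 -(ltr_int R) !intrD; lra.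
Qed.

Lemma a_gt0 (k : nat) : (1 <= k)%N -> 0 < a k.
Proof.
case: k => // k _; elim: k => [|k IH]; first by rewrite a1.
by have := a_step k.+1; lia.
Qed.

Lemma a_incr (i j : nat) : (i < j)%N -> a i < a j.
Proof.
elim: j => // j IH; rewrite ltnS leq_eqVlt => /orP[/eqP->|/IH ij];
  by have := a_step j; lia.
Qed.

Lemma phi_mul_neq_int (k : nat) (z : int) : (1 <= k)%N -> z%:~R <> k%:R * phi.
Proof.
move=> k1 zk.
have k0 : (1 : R) <= k%:R by rewrite ler1n.
have z0 : 0 < z by rewrite -(ltr_int R) zk; have := phi_bounds; nra.
have zE : z = `|z|%N :> int by lia.
(* This is [phi ^ 2 = phi + 1] multiplied by [k ^ 2]. *)
have E : (z * z)%:~R = (z * k%:Z + k%:Z * k%:Z)%:~R :> R.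
  rewrite intrD !intrM zk -pmulrn; ring: phi_sqr.
move/intr_inj: E; rewrite zE => E.
suff /golden_int_eq : (`|z| * `|z| = `|z| * k + k * k)%N by lia.
by lia.
Qed.

Lemma a_bounds_strict (k : nat) :
  (1 <= k)%N -> (a k)%:~R < k%:R * phi < (a k)%:~R + 1.
Proof.
move=> k1; have /andP[le ->] := a_bounds k.
by rewrite andbT lt_neqAle le andbT; apply/eqP/phi_mul_neq_int.
Qed.

Lemma a_natE (j : nat) : (1 <= j)%N -> (`|a j|%N : int) = a j.
Proof. by move/a_gt0; lia. Qed.

Lemma a_a (j : nat) : (1 <= j)%N -> a `|a j| = a j + j%:Z - 1.
Proof.
move=> j1; apply: a_eq.
rewrite pmulrn a_natE // !intrD -pmulrn.
have := a_bounds_strict _ j1; have := phi_bounds; have := phi_sqr.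
set x := (a j)%:~R; set y := j%:R => p2 p b.
(* Here [f = y * phi - x] is the fractional part of [j * phi]; as [0 < f < 1], the subtracted term
   lies strictly between 0 and 1. *)
have -> : x * phi = x + y - (y * phi - x) * (phi - 1) by ring: p2.
by rewrite rmorphN /=; nra.
Qed.

Lemma a_a_succ (j : nat) : (1 <= j)%N -> a `|a j|.+1 = a j + j%:Z + 1.
Proof.
move=> j1; apply: a_eq.
rewrite -natr1 pmulrn a_natE // !intrD -pmulrn.
have := a_bounds_strict _ j1; have := phi_bounds; have := phi_sqr.
set x := (a j)%:~R; set y := j%:R => p2 p b.
(* Now [phi - f * (phi - 1)] lies strictly between 1 and [phi < 2]. *)
have -> : (x + 1) * phi = x + y + phi - (y * phi - x) * (phi - 1) by ring: p2.
by nra.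
Qed.

Lemma a_cover (i : nat) : (1 <= i)%N ->
  exists2 j : nat, (1 <= j)%N & i = `|a j|%N \/ i = `|a j|.+1.
Proof.
case: i => // i _; elim: i => [|i [j j1 [->|->]]].
- by exists 1%N => //; left; rewrite a1.
- by exists j => //; right.
- have := a_step j; have := a_gt0 _ j1 => j0 st.
  exists j.+1 => //.
  (* The next index [a j + 2] is [a j.+1 + 1] or [a j.+1], according to the step. *)
  have [e|e] : a j.+1 = a j + 1 \/ a j.+1 = a j + 2 by lia.
    by right; lia.
  by left; lia.
Qed.

Lemma D2_enum (n : nat) : (2 <= n)%N ->
  increasing_enum (D2 R n)
    (fun k => a k + (2 ^+ (n - 1) - 2) * k%:Z - (2 ^+ (n - 2) - 1)).
Proof.
move=> n2; rewrite /D2 /D1.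
(* Subtraction is truncated, so [2 <= n] is what gives [2 ^ (n - 1) = 2 m]. *)
have -> : (n - 1 = (n - 2).+1)%N by lia.
rewrite exprS; set m : int := 2 ^+ (n - 2).
have m1 : 1 <= m by rewrite exprn_ege1.
set e := (X in increasing_enum _ X).
have e_a j : (1 <= j)%N -> e `|a j|%N = (2 * m - 1) * a j + j%:Z - m.
  by move=> j1; rewrite /e a_a // a_natE //; ring.
have e_aS j : (1 <= j)%N -> e `|a j|.+1 = (2 * m - 1) * a j + j%:Z + m.
  by move=> j1; rewrite /e a_a_succ // intS a_natE //; ring.
split=> [i j /andP[_ ij]|].
  (* The slope [2 m - 2] is nonnegative, possibly 0, so strictness comes from [a]. *)
  by rewrite /e; have := a_incr _ _ ij; nia.
apply/seteqP; split=> [_ [i /= i1 <-]|z].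
  have [j j1 [->|->]] := a_cover _ i1.
    by rewrite e_a //; left; eexists; first by exists j.
  by rewrite e_aS //; right; eexists; first by exists j.
case=> [[_ [j /= j1 <-] <-]|[_ [j /= j1 <-] <-]].
  by exists `|a j|%N; rewrite ?e_a //=; have := a_gt0 _ j1; lia.
by exists `|a j|.+1; rewrite ?e_aS.
Qed.

End GoldenBeatty.

Theorem theorem4p2 (R : realType) (n : nat) (hn : (2 <= n)%N) :
  (exists d : nat -> int, increasing_enum (D2 R n) d) /\
  (forall d : nat -> int, increasing_enum (D2 R n) d ->
     forall k : nat, (1 <= k)%N ->
       d k = a R k + (2 ^+ (n - 1) - 2) * k%:Z - (2 ^+ (n - 2) - 1)).
Proof.
have He := D2_enum R n hn.
split; first by eexists; exact: He.
by move=> d Hd k k1; rewrite (increasing_enum_uniq Hd He).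
Qed.
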